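(* Let $a,b,c$ be fixed complex numbers with $c\neq 0$, and let $x=(x_n)_{n\in\mathbb{N}}$ and $y=(y_n)_{n\in\mathbb{N}}$ be sequences with $y=\mathscr{Y}_{a,b,c,1}(x)$, i.e. \[ y_n=\sum_{k=1}^n \frac{1}{n!}\bigg[\prod_{j=1}^{k-1}(an+bk+cj+1)\bigg]B_{n,k}(1!x_1,2!x_2,\dots)\quad (n\ge 1). \] Let $X(t)=\sum_{n\ge1}x_nt^n$ and $Y(t)=\sum_{n\ge1}y_nt^n$. Then, as formal power series, \[ X\big(t(1+Y(t))^{a}\big)=\frac1c\Big[1-\big(1+Y(t)\big)^{-c}\Big]\big(1+Y(t)\big)^{-b}. \] *)

(* Defs.v *)
From HB Require Import structures.
From mathcomp Require Import all_boot all_order all_algebra.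
From mathcomp Require Import reals complex.
Set Implicit Arguments.
Unset Strict Implicit.
Unset Printing Implicit Defensive.
Import Order.TTheory GRing.Theory Num.Theory.
Local Open Scope ring_scope.

(* A formal power series is its coefficient sequence; equality of series is
   coefficientwise equality, written =1. *)
Definition fps (K : fieldType) := nat -> K.

Section FormalPowerSeries.
Variable K : fieldType.
Implicit Types (f g : fps K) (a : K).

Definition fps_one : fps K := fun n => (n == 0%N)%:R.

Definition fps_t : fps K := fun n => (n == 1%N)%:R.

Definition fps_add f g : fps K := fun n => f n + g n.

Definition fps_sub f g : fps K := fun n => f n - g n.

Definition fps_scale a f : fps K := fun n => a * f n.

Definition fps_mul f g : fps K := fun n => \sum_(i < n.+1) f i * g (n - i)%N.

Definition fps_exp f (k : nat) : fps K := iter k (fps_mul f) fps_one.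

(* Meaningful for g with zero constant term: then g^k has no term of degree
   less than k, so truncating the sum over k at n loses nothing. *)
Definition fps_comp f g : fps K :=
  fun n => \sum_(k < n.+1) f k * fps_exp g k n.

Definition gbinom a (k : nat) : K := (\prod_(i < k) (a - i%:R)) / k`!%:R.

(* f^a as the binomial series sum_k binom(a, k) (f - 1)^k, for f with constant
   term 1. *)
Definition fps_pow f a : fps K := fps_comp (gbinom a) (fps_sub f fps_one).

(* Sequences are indexed from 1; the value x 0 is ignored. *)
Definition gen_series (x : nat -> K) : fps K :=
  fun n => if n is n'.+1 then x n'.+1 else 0.

(* Here alpha i is the exponent of z_(i+1); the constraint
   sum_i (i+1) alpha_i = n leaves only variables z_1, ..., z_n and exponents at
   most n. *)
Definition bell_poly (n k : nat) (z : nat -> K) : K :=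
  \sum_(alpha : {ffun 'I_n -> 'I_n.+1} |
         (\sum_(i < n) alpha i == k)%N && (\sum_(i < n) i.+1 * alpha i == n)%N)
    n`!%:R / (\prod_(i < n) (alpha i)`!)%N%:R
      * \prod_(i < n) (z i.+1 / i.+1`!%:R) ^+ alpha i.

Definition bell_transform (a b c d : K) (x : nat -> K) (n : nat) : K :=
  \sum_(1 <= k < n.+1)
    n`!%:R^-1
      * (\prod_(1 <= j < k) (a * n%:R + b * k%:R + c * j%:R + d))
      * bell_poly n k (fun i => i`!%:R * x i).

End FormalPowerSeries.

Arguments fps_one {K}.
Arguments fps_t {K}.

(* Main.v *)
Require Import Defs.
From HB Require Import structures.
From mathcomp Require Import all_boot all_order all_algebra.
From mathcomp Require Import boolp ring zify.
From mathcomp Require Import reals complex.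
Set Implicit Arguments.
Unset Strict Implicit.
Unset Printing Implicit Defensive.
Import Order.TTheory GRing.Theory Num.Theory.
Local Open Scope ring_scope.

(** Write a family of powers W^s through H(s) = (W^s - 1)/s; being such a family is the
    differential equation H(s)' = H(0)' (1 + s H(s)).  It is preserved by composition with X
    and, by Lagrange inversion, by the shift H(s)_n := H(s + a n)_n, which replaces W by the
    series W~ with W~(t W(t)^(-a)) = W(t).  Starting from W = (1 - c t)^(-1/c), shifting by b,
    composing with X and shifting by a yields a family whose value H(1) is, by the multinomial
    expansion of the Bell polynomials, the series Y.  The functional equation is then pulled
    back along these substitutions to W^(-c) = 1 - c t. *)

(** * The commutative ring of formal power series *)

Section FpsRing.
Variable K : fieldType.
Implicit Types f g h : fps K.

HB.instance Definition _ := gen_eqMixin (fps K).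
HB.instance Definition _ := gen_choiceMixin (fps K).

Definition fps_zero : fps K := fun=> 0.
Definition fps_opp f : fps K := fun n => - f n.

Lemma fps_addA : associative (@fps_add K).
Proof. by move=> f g h; apply/funext => n; exact: addrA. Qed.

Lemma fps_addC : commutative (@fps_add K).
Proof. by move=> f g; apply/funext => n; exact: addrC. Qed.

Lemma fps_add0 : left_id fps_zero (@fps_add K).
Proof. by move=> f; apply/funext => n; exact: add0r. Qed.

Lemma fps_addN : left_inverse fps_zero fps_opp (@fps_add K).
Proof. by move=> f; apply/funext => n; exact: addNr. Qed.

HB.instance Definition _ :=
  GRing.isZmodule.Build (fps K) fps_addA fps_addC fps_add0 fps_addN.

Lemma fps_mulC : commutative (@fps_mul K).
Proof.
move=> f g; apply/funext => n; rewrite /fps_mul (reindex_inj rev_ord_inj) /=.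
by apply: eq_bigr => i _; rewrite subSS subKn ?[_ * f _]mulrC // -ltnS.
Qed.

(** Lets associativity be inherited from polynomials, since a coefficient of a product only involves
    truncations. *)
Lemma fps_mul_poly f g N n : (n < N)%N ->
  fps_mul f g n = ((\poly_(i < N) f i) * (\poly_(i < N) g i))`_n.
Proof.
move=> ltnN; rewrite coefM; apply: eq_bigr => i _.
have leiN : (i < N)%N by apply: leq_ltn_trans ltnN; rewrite -ltnS.
by rewrite !coef_poly leiN (leq_ltn_trans (leq_subr _ _) ltnN).
Qed.

Lemma fps_mulA : associative (@fps_mul K).
Proof.
move=> f g h; apply/funext => n.
pose t q := \poly_(i < n.+1) (q i : K).
have tM f1 g1 m : (m <= n)%N -> (t (fps_mul f1 g1))`_m = (t f1 * t g1)`_m.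
  by move=> lemn; rewrite coef_poly ltnS lemn; exact: fps_mul_poly.
rewrite !(@fps_mul_poly _ _ n.+1) // -!/(t _).
have -> : (t f * t (fps_mul g h))`_n = (t f * (t g * t h))`_n.
  rewrite !coefM; apply: eq_bigr => i _; rewrite tM ?coefM //; exact: leq_subr.
rewrite mulrA; symmetry; rewrite coefM [RHS]coefM; apply: eq_bigr => i _.
by rewrite tM // -ltnS.
Qed.

Lemma fps_mul1 : left_id fps_one (@fps_mul K).
Proof.
move=> f; apply/funext => n; rewrite /fps_mul big_ord_recl /fps_one eqxx mul1r subn0.
by rewrite big1 ?addr0 // => i _; rewrite mul0r.
Qed.

Lemma fps_mulDl : left_distributive (@fps_mul K) (@fps_add K).
Proof.
move=> f g h; apply/funext => n; rewrite /fps_add /fps_mul -big_split /=.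
by apply: eq_bigr => i _; rewrite mulrDl.
Qed.

Lemma fps_one_neq0 : (fps_one : fps K) != 0.
Proof.
by apply/eqP => /(congr1 (fun f : fps K => f 0%N)) /eqP; rewrite /fps_one oner_eq0.
Qed.

HB.instance Definition _ := GRing.Zmodule_isComNzRing.Build (fps K)
  fps_mulA fps_mulC fps_mul1 fps_mulDl fps_one_neq0.

Lemma coef_fpsD f g n : (f + g) n = f n + g n. Proof. by []. Qed.
Lemma coef_fpsN f n : (- f) n = - f n. Proof. by []. Qed.
Lemma coef_fps1 n : (1 : fps K) n = (n == 0%N)%:R. Proof. by []. Qed.
Lemma coef_fpsM f g n : (f * g) n = \sum_(i < n.+1) f i * g (n - i)%N.
Proof. by []. Qed.

Lemma coef_fps_sum (I : Type) (r : seq I) (P : pred I) (F : I -> fps K) n :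
  (\sum_(i <- r | P i) F i) n = \sum_(i <- r | P i) F i n.
Proof. by elim/big_rec2: _ => // i y1 y2 _ <-. Qed.

Lemma fps_expE f k : fps_exp f k = f ^+ k.
Proof. by elim: k => // k IH; rewrite exprS -IH. Qed.

Definition fpsC (a : K) : fps K := fun n => if n is 0%N then a else 0.

Lemma coef_fpsCM a f n : (fpsC a * f) n = a * f n.
Proof.
rewrite coef_fpsM big_ord_recl /= subn0 big1 ?addr0 // => i _.
by rewrite /= mul0r.
Qed.

Lemma fpsC_is_additive : {morph fpsC : a b / a - b}.
Proof. by move=> a b; apply/funext => -[|n] //; rewrite coef_fpsD coef_fpsN /= subr0. Qed.

Lemma fpsC_is_monoid_morphism : monoid_morphism fpsC.
Proof.
split; first by apply/funext => -[].
by move=> a b; apply/funext => n; rewrite coef_fpsCM; case: n => [|n] //=; rewrite mulr0.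
Qed.

HB.instance Definition _ := GRing.isZmodMorphism.Build K (fps K) fpsC fpsC_is_additive.
HB.instance Definition _ :=
  GRing.isMonoidMorphism.Build K (fps K) fpsC fpsC_is_monoid_morphism.

Lemma coef_fps_tM f n : (fps_t * f) n = if n is m.+1 then f m else 0.
Proof.
case: n => [|n]; first by rewrite coef_fpsM big_ord1 mul0r.
rewrite coef_fpsM big_ord_recl mul0r add0r big_ord_recl big1 => [|i _].
  by rewrite addr0 mul1r subn1.
by rewrite mul0r.
Qed.

(** Identities between derivatives are checked through t d/dt, which multiplies coefficient n by
    n. *)
Lemma fps_t_inj f g : fps_t * f = fps_t * g -> f = g.
Proof.
move=> e; apply/funext => n.
by move: (congr1 (fun h : fps K => h n.+1) e); rewrite /= !coef_fps_tM.
Qed.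

Lemma coef_fps_tXM k f n :
  (fps_t ^+ k * f) n = if (k <= n)%N then f (n - k)%N else 0.
Proof.
elim: k n => [|k IH] n; first by rewrite mul1r subn0.
by rewrite exprS -mulrA coef_fps_tM; case: n => [|n] //; rewrite IH.
Qed.

Lemma coef_fpsM0 f g : (f * g) 0%N = f 0%N * g 0%N.
Proof. by rewrite coef_fpsM big_ord1. Qed.

Lemma coef_fpsX_lt g k n : g 0%N = 0 -> (n < k)%N -> (g ^+ k) n = 0.
Proof.
move=> g0; elim: k n => // k IH n ltnk; rewrite exprS coef_fpsM big1 // => -[[|i] lti] _ /=.
  by rewrite g0 mul0r.
by rewrite IH ?mulr0 // ltn_subLR; lia.
Qed.

(** * Formal derivation *)

Definition fps_deriv f : fps K := fun n => n.+1%:R * f n.+1.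

Lemma coef_fps_tD f n : (fps_t * fps_deriv f) n = n%:R * f n.
Proof. by rewrite coef_fps_tM; case: n => [|n] //; rewrite mul0r. Qed.

Lemma fps_derivD f g : fps_deriv (f + g) = fps_deriv f + fps_deriv g.
Proof. by apply/funext => n; rewrite /fps_deriv coef_fpsD mulrDr. Qed.

Lemma fps_derivC a : fps_deriv (fpsC a) = 0.
Proof. by apply/funext => n; rewrite /fps_deriv mulr0. Qed.

Lemma fps_derivM f g :
  fps_deriv (f * g) = fps_deriv f * g + f * fps_deriv g.
Proof.
apply: fps_t_inj; rewrite mulrDr mulrA [fps_t * (f * _)]mulrCA.
apply/funext => n; rewrite coef_fps_tD coef_fpsD !coef_fpsM mulr_sumr -big_split.
apply: eq_bigr => i _; rewrite !coef_fps_tD /=.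
rewrite mulrA -(mulrA _ _ (g _)) -mulrA -[f i * (_ * _)]mulrCA -mulrDl -natrD subnKC //.
by rewrite -ltnS.
Qed.

Lemma fps_derivCM a f : fps_deriv (fpsC a * f) = fpsC a * fps_deriv f.
Proof. by rewrite fps_derivM fps_derivC mul0r add0r. Qed.

Lemma fps_deriv1 : fps_deriv 1 = 0.
Proof. by rewrite -(rmorph1 fpsC) fps_derivC. Qed.

Lemma fps_deriv_t : fps_deriv fps_t = 1.
Proof. by apply/funext => -[|n]; rewrite /fps_deriv ?mulr1 // mulr0. Qed.

Lemma fps_derivX f k :
  fps_deriv (f ^+ k.+1) = fpsC k.+1%:R * f ^+ k * fps_deriv f.
Proof.
elim: k => [|k IH]; first by rewrite expr1 expr0 rmorph1 !mul1r.
by rewrite exprS fps_derivM IH [in fpsC k.+2%:R]mulrS rmorphD rmorph1 exprS; ring.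
Qed.

(** * Composition with a series without constant term *)

Lemma coef_fps_comp f g n N : g 0%N = 0 -> (n <= N)%N ->
  fps_comp f g n = \sum_(k < N.+1) f k * (g ^+ k) n.
Proof.
move=> g0 lenN; rewrite /fps_comp; under eq_bigr do rewrite fps_expE.
rewrite -!(big_mkord xpredT (fun k => f k * (g ^+ k) n)).
rewrite [RHS](big_cat_nat (n := n.+1)) //= [X in _ + X]big_nat_cond.
by rewrite [X in _ + X]big1 ?addr0 // => k; rewrite andbT => /andP[ltnk _];
   rewrite coef_fpsX_lt ?mulr0.
Qed.

Lemma coef_fps_compM f g h n : g 0%N = 0 ->
  (fps_comp f g * h) n = \sum_(k < n.+1) f k * (g ^+ k * h) n.
Proof.
move=> g0; rewrite coef_fpsM.
under eq_bigr => i _.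
  rewrite (@coef_fps_comp _ _ _ n) ?mulr_suml //; last by rewrite -ltnS.
  over.
rewrite exchange_big; apply: eq_bigr => k _ /=.
by rewrite coef_fpsM mulr_sumr; apply: eq_bigr => i _; rewrite mulrA.
Qed.

Lemma fps_compD f1 f2 g : fps_comp (f1 + f2) g = fps_comp f1 g + fps_comp f2 g.
Proof.
apply/funext => n; rewrite coef_fpsD -big_split; apply: eq_bigr => k _.
by rewrite coef_fpsD mulrDl.
Qed.

Lemma fps_compCM a f g : fps_comp (fpsC a * f) g = fpsC a * fps_comp f g.
Proof.
apply/funext => n; rewrite coef_fpsCM mulr_sumr; apply: eq_bigr => k _.
by rewrite coef_fpsCM mulrA.
Qed.

Lemma fps_compB f1 f2 g : fps_comp (f1 - f2) g = fps_comp f1 g - fps_comp f2 g.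
Proof. by rewrite -[- f2]mulN1r -(rmorphN1 fpsC) fps_compD fps_compCM rmorphN1 mulN1r. Qed.

Lemma fps_comp1 g : fps_comp 1 g = 1.
Proof.
apply/funext => n; rewrite /fps_comp big_ord_recl mul1r big1 ?addr0 // => i _.
by rewrite mul0r.
Qed.

Lemma fps_compt g : g 0%N = 0 -> fps_comp fps_t g = g.
Proof.
move=> g0; apply/funext => n; rewrite (@coef_fps_comp _ _ _ n.+1) //.
rewrite big_ord_recl mul0r add0r big_ord_recl mul1r big1 ?addr0 // => i _.
by rewrite mul0r.
Qed.

Lemma fps_comp_idr f : fps_comp f fps_t = f.
Proof.
apply/funext => n; rewrite /fps_comp big_ord_recr /= big1 => [|i _].
  by rewrite add0r fps_expE -[_ ^+ n]mulr1 coef_fps_tXM leqnn subnn mulr1.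
rewrite fps_expE -[_ ^+ i]mulr1 coef_fps_tXM ltnW // coef_fps1 subn_eq0 leqNgt ltn_ord.
by rewrite mulr0.
Qed.

Lemma fps_comp_tM f g : g 0%N = 0 -> fps_comp (fps_t * f) g = g * fps_comp f g.
Proof.
move=> g0; apply/funext => n; rewrite [g * _]mulrC coef_fps_compM //.
rewrite (@coef_fps_comp _ _ _ n.+1) // big_ord_recl coef_fps_tM mul0r add0r.
by apply: eq_bigr => k _; rewrite coef_fps_tM /= exprSr.
Qed.

Lemma fps_comp_coef0 f g : fps_comp f g 0%N = f 0%N.
Proof. by rewrite /fps_comp big_ord1 mulr1. Qed.

(** Both sides sum f1_i f2_j [t^n] g^(i+j), the left over i + j <= n and the right over i, j <= n;
    the extra terms vanish because g^(i+j) starts in degree at least i + j. *)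
Lemma fps_compM f1 f2 g : g 0%N = 0 ->
  fps_comp (f1 * f2) g = fps_comp f1 g * fps_comp f2 g.
Proof.
move=> g0; apply/funext => n; rewrite coef_fps_compM //.
under [RHS]eq_bigr => k _.
  rewrite [_ * fps_comp _ _]mulrC coef_fps_compM // mulr_sumr.
  over.
rewrite (@coef_fps_comp _ _ _ n) //.
rewrite [LHS](eq_bigr (fun k : 'I_n.+1 => \sum_(i < k.+1) f1 i * f2 (k - i)%N * (g ^+ k) n)); last first.
  by move=> k _; rewrite coef_fpsM mulr_suml.
pose F i j := f1 i * f2 j * (g ^+ (i + j)) n.
transitivity (\sum_(k < n.+1) \sum_(i < n.+1 | (i <= k)%N) F i (k - i)%N).
  apply: eq_bigr => k _; rewrite (big_ord_widen n.+1 (fun i => f1 i * f2 (k - i)%N * (g ^+ k) n)) //.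
  by apply: eq_bigr => i lik; rewrite /F subnKC.
rewrite (exchange_big_dep xpredT) //=; apply: eq_bigr => i _.
rewrite -(big_mkord (fun k => (i <= k)%N) (fun k => F i (k - i)%N)).
transitivity (\sum_(0 <= j < (n.+1 - i)) F i j).
  rewrite (big_cat_nat (n := i)) //=; last by rewrite ltnW.
  rewrite big_nat_cond big_pred0 => [|k]; last by apply/negbTE; lia.
  rewrite add0r -{1}[i : nat]add0n big_addn; rewrite big_nat_cond [RHS]big_nat_cond.
  apply: eq_big => [j|j _]; last by rewrite addnK.
  by rewrite leq_addl andbT.
rewrite [RHS](eq_bigr (fun j : 'I_n.+1 => F i j)); last first.
  by move=> j _; rewrite /F exprD [g ^+ i * _]mulrC mulrA.
rewrite -(big_mkord xpredT (F i)) [RHS](big_cat_nat (n := (n.+1 - i)%N)) ?leq_subr //=.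
rewrite [X in _ + X]big_nat_cond [X in _ + X]big1 ?addr0 // => j /andP[/andP[leij _] _].
by rewrite /F coef_fpsX_lt ?mulr0 //; move: (ltn_ord i); lia.
Qed.

Lemma fps_compX f g k : g 0%N = 0 -> fps_comp (f ^+ k) g = fps_comp f g ^+ k.
Proof.
move=> g0; elim: k => [|k IH]; first exact: fps_comp1.
by rewrite !exprS fps_compM // IH.
Qed.

Lemma fps_compA f g h : g 0%N = 0 -> h 0%N = 0 ->
  fps_comp (fps_comp f g) h = fps_comp f (fps_comp g h).
Proof.
move=> g0 h0; apply/funext => n.
have gh0 : fps_comp g h 0%N = 0 by rewrite fps_comp_coef0.
rewrite (@coef_fps_comp _ _ _ n) //.
under eq_bigr => k _.
  rewrite (@coef_fps_comp _ _ _ n) //; last by rewrite -ltnS.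
  rewrite mulr_suml; over.
rewrite (@coef_fps_comp _ (fps_comp g h) _ n) // exchange_big; apply: eq_bigr => k _ /=.
rewrite -fps_compX // (@coef_fps_comp _ _ _ n) // mulr_sumr.
by apply: eq_bigr => i _; rewrite mulrA.
Qed.

Lemma fps_deriv_comp f g : g 0%N = 0 ->
  fps_deriv (fps_comp f g) = fps_comp (fps_deriv f) g * fps_deriv g.
Proof.
move=> g0; apply/funext => n; rewrite coef_fps_compM // /fps_deriv.
rewrite (@coef_fps_comp _ _ _ n.+1) // mulr_sumr big_ord_recl expr0 coef_fps1 !mulr0 add0r.
apply: eq_bigr => k _ /=; rewrite mulrCA -/(fps_deriv (g ^+ k.+1) n) fps_derivX.
by rewrite -mulrA coef_fpsCM mulrCA mulrA.
Qed.

End FpsRing.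

(** * Families of powers and their differential equation *)

Section PowerFamilies.
Variable K : numFieldType.
Implicit Types (f g : fps K) (H : K -> fps K) (a b c r s : K).

Lemma fps_deriv_inj f g : f 0%N = g 0%N -> fps_deriv f = fps_deriv g -> f = g.
Proof.
move=> e0 eD; apply/funext => -[//|n].
move: (congr1 (fun h : fps K => h n) eD); rewrite /= /fps_deriv.
by apply: mulfI; rewrite pnatr_eq0.
Qed.

(** The equation determines coefficient n + 1 from the earlier ones, as n + 1 is invertible in
    characteristic 0. *)
Lemma fps_ode_uniq (l f g : fps K) :
  f 0%N = g 0%N -> fps_deriv f = l * f -> fps_deriv g = l * g -> f = g.
Proof.
move=> e0 ef eg; apply/funext; elim/ltn_ind => -[//|n] IH.
have nz : n.+1%:R != 0 :> K by rewrite pnatr_eq0.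
apply: (mulfI nz); rewrite -/(fps_deriv f n) -/(fps_deriv g n) ef eg !coef_fpsM.
by apply: eq_bigr => i _; rewrite IH // ltnS leq_subr.
Qed.

(** Recovers W^s from H(s) = (W^s - 1)/s. *)
Definition fps_of_log H s : fps K := 1 + fpsC s * H s.

(* H s stands for (W^s - 1) / s, read as log W at s = 0, where W is a series with
   constant term 1: the second condition is (W^s)' = s (log W)' W^s divided by s. *)
Definition pow_family H :=
  (forall s, H s 0%N = 0) /\
  (forall s, fps_deriv (H s) = fps_deriv (H 0) * fps_of_log H s).

(** For n >= 1, s times this coefficient is the Lagrange expression s/(s + a n) [t^n] W^(s + a n);
    working with H avoids the pole at s + a n = 0. *)
Definition pow_shift H a s : fps K := fun n => H (s + a * n%:R) n.

Section Family.
Variable H : K -> fps K.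
Hypothesis famH : pow_family H.
Local Notation V := (fps_of_log H).
Local Notation l := (fps_deriv (H 0)).

Lemma pow_family_coef0 s : V s 0%N = 1.
Proof. by rewrite /fps_of_log coef_fpsD coef_fpsCM famH.1 mulr0 addr0. Qed.

Lemma pow_family_deriv s : fps_deriv (V s) = fpsC s * l * V s.
Proof.
by rewrite /fps_of_log fps_derivD fps_deriv1 add0r fps_derivCM famH.2 mulrA.
Qed.

Lemma pow_family0 : V 0 = 1.
Proof. by rewrite /fps_of_log rmorph0 mul0r addr0. Qed.

(** Both sides solve F' = (r + s) l F with constant term 1. *)
Lemma pow_familyD r s : V (r + s) = V r * V s.
Proof.
apply: (@fps_ode_uniq (fpsC (r + s) * l)).
- by rewrite coef_fpsM0 !pow_family_coef0 mulr1.
- exact: pow_family_deriv.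
- by rewrite fps_derivM !pow_family_deriv rmorphD; ring.
Qed.

Lemma pow_familyX s k : V s ^+ k = V (k%:R * s).
Proof.
elim: k => [|k IH]; first by rewrite mul0r pow_family0.
by rewrite exprS IH -pow_familyD mulrS mulrDl mul1r.
Qed.

Lemma gbinom_coef0 s : (gbinom s : fps K) 0%N = 1.
Proof. by rewrite /gbinom big_ord0 fact0 divr1. Qed.

Lemma gbinom_deriv s :
  (1 + fps_t) * fps_deriv (gbinom s) = fpsC s * gbinom s.
Proof.
apply/funext => n; rewrite mulrDl mul1r coef_fpsD coef_fps_tD coef_fpsCM.
rewrite /fps_deriv /gbinom big_ord_recr factS natrM /=.
have n0 : n.+1%:R != 0 :> K by rewrite pnatr_eq0.
have f0 : n`!%:R != 0 :> K by rewrite pnatr_eq0 -lt0n fact_gt0.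
by move: n0; rewrite -natr1 => n0; field; rewrite f0 n0.
Qed.

(** Ties the binomial-series power to the family: both sides solve F' = s l F with constant term
    1. *)
Lemma fps_pow_family s : fps_pow (V 1) s = V s.
Proof.
rewrite /fps_pow -[fps_sub _ _]/(V 1 - 1); set Z := V 1 - 1.
have Z0 : Z 0%N = 0 by rewrite /Z coef_fpsD coef_fpsN pow_family_coef0 subrr.
have DZ : fps_deriv Z = l * (1 + Z).
  rewrite /Z fps_derivD pow_family_deriv rmorph1 mul1r addrC -(rmorphN1 (@fpsC K)).
  by rewrite fps_derivC add0r rmorphN1 addrC subrK.
apply: (@fps_ode_uniq (fpsC s * l)).
- by rewrite fps_comp_coef0 gbinom_coef0 pow_family_coef0.
(* The binomial equation composed with Z carries a factor 1 + Z, which [DZ] supplies through the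
   chain rule. *)
- have := congr1 (fun h : fps K => fps_comp h Z) (gbinom_deriv s).
  rewrite /= fps_compM // fps_compD fps_comp1 fps_compt // fps_compCM => E.
  rewrite fps_deriv_comp // DZ mulrAC -E; ring.
- exact: pow_family_deriv.
Qed.

(** * Lagrange inversion along phi = t W^(-a) *)

Section Shift.
Variable a : K.
Local Notation H' := (pow_shift H a).
Local Notation phi := (fps_t * V (- a)).
Local Notation jac := (1 - fpsC a * fps_t * l).
(** The coefficient extraction of Lagrange's formula; it turns out to be the inverse of the map
    sending e to e(phi) jac. *)
Definition lagrange_coef f : fps K := fun n => (f * V (a * n%:R)) n.
Local Notation M := lagrange_coef.

Lemma lagrange_phi0 : phi 0%N = 0.
Proof. by rewrite coef_fps_tM. Qed.

Lemma lagrange_tderiv_phi : fps_t * fps_deriv phi = phi * jac.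
Proof.
rewrite fps_derivM fps_deriv_t pow_family_deriv rmorphN; ring.
Qed.

(* As jac = t phi'/phi and W^(ad) = (t/phi)^d, this is the residue of phi' phi^(-d-1). *)
Lemma lagrange_residue d : (jac * V (a * d%:R)) d = (d == 0%N)%:R.
Proof.
have -> : jac * V (a * d%:R)
    = V (a * d%:R) - fpsC a * (fps_t * fps_deriv (H (a * d%:R))).
  by rewrite (famH.2 (a * d%:R)); ring.
(* Both terms contribute a d times coefficient d of H(a d), with opposite signs, so only the
   constant 1 remains. *)
rewrite coef_fpsD coef_fpsN coef_fpsCM coef_fps_tD /fps_of_log coef_fpsD coef_fpsCM.
by rewrite coef_fps1; ring.
Qed.

(** Expanding e(phi) in powers of phi, phi^k jac W^(a n) = t^k jac W^(a (n - k)), whose coefficient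
    n is the residue for d = n - k; only k = n survives. *)
Lemma lagrange_inversion e : M (fps_comp e phi * jac) = e.
Proof.
apply/funext => n; rewrite /lagrange_coef -mulrA coef_fps_compM ?lagrange_phi0 //.
have E k : (k <= n)%N ->
    (phi ^+ k * (jac * V (a * n%:R))) n = ((n - k)%N == 0%N)%:R.
  move=> lekn; rewrite exprMn pow_familyX.
  have -> : fps_t ^+ k * V (k%:R * - a) * (jac * V (a * n%:R))
     = fps_t ^+ k * (jac * (V (k%:R * - a) * V (a * n%:R))) by ring.
  rewrite -pow_familyD coef_fps_tXM lekn -lagrange_residue.
  by do 2!congr (_ _); congr (_ * V _); rewrite natrB //; ring.
rewrite big_ord_recr /= E // subnn mulr1 big1 ?add0r // => k _.
by rewrite E 1?ltnW // subn_eq0 leqNgt ltn_ord mulr0.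
Qed.

(** M is triangular with unit diagonal, because W^(a n) has constant term 1. *)
Lemma lagrange_M_inj f g : M f = M g -> f = g.
Proof.
move=> e; apply/funext; elim/ltn_ind => n IH.
move: (congr1 (fun h : fps K => h n) e); rewrite /lagrange_coef /= !coef_fpsM.
rewrite !big_ord_recr /= subnn pow_family_coef0 !mulr1.
rewrite (eq_bigr (fun i : 'I_n => g i * V (a * n%:R) (n - i)%N)) => [/addrI //|i _].
by rewrite IH.
Qed.

Lemma lagrange_comp_inj e f : fps_comp e phi = fps_comp f phi -> e = f.
Proof. by move=> E; rewrite -[e]lagrange_inversion E lagrange_inversion. Qed.

Lemma lagrange_M f : fps_comp (M f) phi * jac = f.
Proof. by apply: lagrange_M_inj; rewrite lagrange_inversion. Qed.

(** The family equation gives l W^(s + a n) = H(s + a n)', so coefficient n on the left is n H(s + a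
    n)_n. *)
Lemma lagrange_M_log s : M (fps_t * l * V s) = fps_t * fps_deriv (H' s).
Proof.
apply/funext => n; rewrite /lagrange_coef -mulrA -pow_familyD -mulrA -famH.2.
by rewrite !coef_fps_tD.
Qed.

(** By the chain rule, t d/dt of the left side is t d/dt [H' s] composed with phi, times jac. The
    first factor is M of t l W^s composed with phi, and inversion leaves t l W^s, which is t d/dt
    [H s]. *)
Lemma lagrange_comp_log s : fps_comp (H' s) phi = H s.
Proof.
apply: fps_deriv_inj; first by rewrite fps_comp_coef0 /pow_shift !famH.1.
apply: fps_t_inj; rewrite fps_deriv_comp ?lagrange_phi0 // mulrCA.
rewrite lagrange_tderiv_phi (famH.2 s) [LHS]mulrCA [LHS]mulrA.
by rewrite -fps_comp_tM ?lagrange_phi0 // -lagrange_M_log lagrange_M -mulrA.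
Qed.

Lemma lagrange_comp s : fps_comp (fps_of_log H' s) phi = V s.
Proof. by rewrite fps_compD fps_comp1 fps_compCM lagrange_comp_log. Qed.

(** Composition with phi is injective, and it sends both sides of the equation, multiplied by t, to
    t l W^s / jac. *)
Lemma pow_family_shift : pow_family H'.
Proof.
split=> [s|s]; first by rewrite /pow_shift famH.1.
apply: fps_t_inj; rewrite mulrA -lagrange_M_log; apply: lagrange_comp_inj.
rewrite fps_compM ?lagrange_phi0 // lagrange_comp.
have V1 : M (fps_t * l) = fps_t * fps_deriv (H' 0).
  by rewrite -lagrange_M_log pow_family0 mulr1.
have := lagrange_M (fps_t * l * V s); rewrite -{2}[fps_t * l]lagrange_M V1 => E.
have : (fps_comp (M (fps_t * l * V s)) phi
        - fps_comp (fps_t * fps_deriv (H' 0)) phi * V s) * jac = 0.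
  by rewrite mulrBl E; ring.
(* jac has constant term 1, so it cancels: the coefficients of q vanish by induction. *)
set q := _ - _ => q0; apply/eqP; rewrite -subr_eq0 -/q; apply/eqP.
have jac0 : jac 0%N = 1.
  by rewrite coef_fpsD coef_fpsN -mulrA coef_fpsCM coef_fps_tM mulr0 subr0.
apply/funext; elim/ltn_ind => n IH.
move: (congr1 (fun h : fps K => h n) q0); rewrite coef_fpsM big_ord_recr /= subnn jac0 mulr1.
by rewrite big1 ?add0r // => i _; rewrite IH ?mul0r.
Qed.

End Shift.

(** * Composition of families, and the starting family *)

Lemma pow_family_comp g : g 0%N = 0 -> pow_family (fun s => fps_comp (H s) g).
Proof.
move=> g0; split=> s; first by rewrite fps_comp_coef0 famH.1.
rewrite !fps_deriv_comp // famH.2 fps_compM // {2}/fps_of_log fps_compD fps_comp1 fps_compCM.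
by rewrite /fps_of_log; ring.
Qed.

End Family.

(* ((1 - c t)^(-s/c) - 1) / s *)
Definition rising_log c s : fps K :=
  fun k => if k is 0%N then 0 else (\prod_(1 <= j < k) (s + c * j%:R)) / k`!%:R.

Lemma rising_log_deriv c s :
  (1 - fpsC c * fps_t) * fps_deriv (rising_log c s) = fps_of_log (rising_log c) s.
Proof.
apply/funext => k; rewrite mulrBl mul1r -mulrA coef_fpsD coef_fpsN coef_fpsCM coef_fps_tD.
rewrite /fps_of_log coef_fpsD coef_fpsCM coef_fps1 /fps_deriv /rising_log.
case: k => [|k]; first by rewrite big_geq // divr1 mul0r !mulr0 subr0 addr0 mulr1.
rewrite [in \prod_(1 <= j < k.+2) _]big_nat_recr //= (factS k.+1) natrM.
have n0 : k.+2%:R != 0 :> K by rewrite pnatr_eq0.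
have f0 : k.+1`!%:R != 0 :> K by rewrite pnatr_eq0 -lt0n fact_gt0.
set P := \prod_(_ <= _ < _) _.
move: (k.+2%:R : K) (k.+1`!%:R : K) n0 f0 => u v u0 v0.
by rewrite add0r; field; rewrite u0 v0.
Qed.

(** The case s = 0 of the previous equation makes H(0)' the inverse of 1 - c t. *)
Lemma pow_family_rising c : pow_family (rising_log c).
Proof.
split=> // s; rewrite -rising_log_deriv mulrCA.
have := rising_log_deriv c 0; rewrite /fps_of_log rmorph0 mul0r addr0 => E.
by rewrite mulrA E mul1r.
Qed.

(** At s = -c the factor j = 1 vanishes, which kills every degree from 2 on. *)
Lemma rising_logN c : fps_of_log (rising_log c) (- c) = 1 - fpsC c * fps_t.
Proof.
apply/funext => -[|[|k]]; rewrite /fps_of_log !coef_fpsD coef_fpsN !coef_fpsCM /=.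
- by rewrite !mulr0 subr0 addr0.
- by rewrite big_geq // divr1 !mulr1.
by rewrite big_ltn // mulr1 addNr !mul0r !mulr0 subr0 addr0.
Qed.

End PowerFamilies.

(** * Bell polynomials as coefficients of powers *)

Section BellPolynomials.
Variable K : numFieldType.
Implicit Types (x : nat -> K) (e : nat -> fps K).

Lemma fact_neq0 n : n`!%:R != 0 :> K.
Proof. by rewrite pnatr_eq0 -lt0n fact_gt0. Qed.

(** The exponential of z f cut after z^N; the cut makes the exponents range over ['I_N.+1], as in
    [bell_poly]. *)
Definition trunc_exp N (f : fps K) : {poly fps K} :=
  \poly_(j < N.+1) (fpsC j`!%:R^-1 * f ^+ j).

(* exp(z e_0) ... exp(z e_(m-1)) = exp(z (e_0 + ... + e_(m-1))), with z the polynomial variable. *)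
Lemma coef_prod_trunc_exp N m e k : (k <= N)%N ->
  (\prod_(i < m) trunc_exp N (e i))`_k = fpsC k`!%:R^-1 * (\sum_(i < m) e i) ^+ k.
Proof.
elim: m k => [|m IH] k lekN.
  rewrite !big_ord0 coef1 expr0n; case: k lekN => [|k] _; last by rewrite mulr0.
  by rewrite invr1 mulr1; exact: esym (rmorph1 (@fpsC K)).
rewrite !big_ord_recr /= coefM [_ + e m]addrC exprDn mulr_sumr; apply: eq_bigr => j _.
have lejk : (j <= k)%N by rewrite -ltnS.
rewrite IH ?(leq_trans lejk) // coef_poly ltnS (leq_trans (leq_subr _ _) lekN).
have -> : j`!%:R^-1 = k`!%:R^-1 * 'C(k, j)%:R * (k - j)`!%:R :> K.
  rewrite -(bin_fact lejk) !natrM.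
  have Ck0 : 'C(k, j)%:R != 0 :> K by rewrite pnatr_eq0 -lt0n bin_gt0.
  by field; rewrite Ck0 !fact_neq0.
have := mulfV (fact_neq0 (k - j)).
move: ((k - j)`!%:R) => v v1.
have {}v1 : fpsC v * fpsC v^-1 = 1 by rewrite -rmorphM v1 rmorph1.
rewrite !rmorphM /= rmorph_nat -[_ *+ 'C(k, j)]mulr_natr.
set S := \sum_(_ < _) _; set q := fpsC _.
transitivity (q * 'C(k, j)%:R * (fpsC v * fpsC v^-1) * (S ^+ j * e m ^+ (k - j))); first by ring.
by rewrite v1; ring.
Qed.

Lemma coef_fpsX_eq (f g : fps K) n k :
  (forall m, (m <= n)%N -> f m = g m) -> (f ^+ k) n = (g ^+ k) n.
Proof.
elim: k n => [//|k IH] n fg; rewrite [f ^+ _]exprS [g ^+ _]exprS !coef_fpsM.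
apply: eq_bigr => i _.
rewrite fg -1?ltnS //; congr (_ * _); apply: IH => m lem.
by apply: fg; apply: leq_trans lem _; rewrite leq_subr.
Qed.

Lemma coef_trunc_gen_series x n m : (m <= n)%N ->
  (\sum_(i < n) fpsC (x i.+1) * fps_t ^+ i.+1 : fps K) m = gen_series x m.
Proof.
move=> lemn; rewrite coef_fps_sum.
have E (i : 'I_n) : (fpsC (x i.+1) * fps_t ^+ i.+1) m = if i.+1 == m then x m else 0.
  rewrite coef_fpsCM -[fps_t ^+ _]mulr1 coef_fps_tXM coef_fps1 subn_eq0.
  by case: (ltngtP i.+1 m) => [||->]; rewrite ?mulr0 ?mulr1.
rewrite (eq_bigr _ (fun i _ => E i)); case: m lemn {E} => [|m] ltmn.
  by rewrite big1.
by rewrite (bigD1 (Ordinal ltmn)) //= eqxx big1 ?addr0 // => i; rewrite -val_eqE eqSS => /negbTE ->.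
Qed.

(** The multinomial theorem: the coefficient of z^k t^n in the product of the series exp(z x_i t^i),
    i = 1..n, is computed once from the sum of the exponents and once by distributing the product
    over all alpha. *)
Lemma bell_polyE x n k : (k <= n)%N ->
  bell_poly n k (fun i => i`!%:R * x i) = n`!%:R / k`!%:R * (gen_series x ^+ k) n.
Proof.
move=> lekn; pose e i := fpsC (x i.+1) * fps_t ^+ i.+1.
have := congr1 (fun h : fps K => h n) (coef_prod_trunc_exp n e lekn).
rewrite /= coef_fpsCM (coef_fpsX_eq _ (@coef_trunc_gen_series x n)) => E.
rewrite -mulrA -E {E}.
under eq_bigr do rewrite /trunc_exp poly_def.
rewrite bigA_distr_bigA coef_sum coef_fps_sum mulr_sumr /bell_poly.
rewrite [RHS](bigID (fun alpha : {ffun 'I_n -> 'I_n.+1} =>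
  (\sum_(i < n) alpha i == k)%N && (\sum_(i < n) i.+1 * alpha i == n)%N)) /=.
(* The choice alpha yields one monomial, of z-degree the sum of alpha and t-degree its weighted sum:
   the two constraints on alpha say that these are k and n. *)
have F (alpha : {ffun 'I_n -> 'I_n.+1}) :
  (\prod_(i < n) ((fpsC (alpha i)`!%:R^-1 * e i ^+ alpha i) *: 'X^(alpha i)))`_k n
  = ((\sum_(i < n) alpha i == k)%N && (\sum_(i < n) i.+1 * alpha i == n)%N)%:R
    * \prod_(i < n) ((alpha i)`!%:R^-1 * x i.+1 ^+ alpha i).
  rewrite scaler_prod prodrXr coefZ coefXn eq_sym.
  have -> : \prod_(i < n) (fpsC (alpha i)`!%:R^-1 * e i ^+ alpha i)
    = fpsC (\prod_(i < n) ((alpha i)`!%:R^-1 * x i.+1 ^+ alpha i))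
      * fps_t ^+ (\sum_(i < n) i.+1 * alpha i).
    rewrite -prodrXr rmorph_prod -big_split; apply: eq_bigr => i _ /=.
    by rewrite rmorphM rmorphXn /e exprMn -exprM mulrA.
  case: eqP => _; last by rewrite mulr0 mul0r.
  rewrite mulr1 coef_fpsCM -[fps_t ^+ _]mulr1 coef_fps_tXM coef_fps1 subn_eq0 mulrC.
  by case: ltngtP; rewrite ?mul0r.
rewrite [X in _ + X]big1 ?addr0 => [|alpha /negbTE nP]; last by rewrite F nP mul0r mulr0.
apply: eq_bigr => alpha P; rewrite F P mul1r big_split /= mulrA prodfV natr_prod.
by congr (_ * _); apply: eq_bigr => i _; rewrite mulrAC mulfV ?fact_neq0 // mul1r.
Qed.

(** The inner shift puts b k and the outer one a n into the exponent, starting from s = 1, the value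
    of the parameter d; the n! cancels and 1/k! is the denominator of [rising_log]. *)
Lemma bell_transformE (a b c : K) x n : (0 < n)%N ->
  bell_transform a b c 1 x n
  = pow_shift (fun s => fps_comp (pow_shift (rising_log c) b s) (gen_series x)) a 1 n.
Proof.
move=> n_gt0; rewrite /bell_transform /pow_shift /fps_comp.
rewrite -(big_mkord xpredT (fun k => rising_log c (1 + a * n%:R + b * k%:R) k
                                     * fps_exp (gen_series x) k n)).
(* The term k = 0 vanishes since [rising_log] has no constant term. *)
rewrite [RHS]big_ltn // mul0r add0r [LHS]big_nat_cond [RHS]big_nat_cond.
apply: eq_bigr => -[//|k] /andP[/andP[_ lekn] _]; rewrite bell_polyE // fps_expE /=.
rewrite (eq_bigr (fun j => 1 + a * n%:R + b * k.+1%:R + c * j%:R)) => [|j _]; last by ring.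
set P := \prod_(_ <= _ < _) _; have := fact_neq0 n; have := fact_neq0 k.+1.
by move: (n`!%:R) (k.+1`!%:R) => u v v0 u0; field; rewrite u0 v0.
Qed.

End BellPolynomials.

(** * The functional equation *)

Lemma bell_transform_series (K : numFieldType) (a b c : K) (x y : nat -> K) :
  c != 0 -> (forall n, (0 < n)%N -> y n = bell_transform a b c 1 x n) ->
  let Y1 := fps_add fps_one (gen_series y) in
  fps_comp (gen_series x) (fps_t * fps_pow Y1 a)
  = fpsC c^-1 * ((1 - fps_pow Y1 (- c)) * fps_pow Y1 (- b)).
Proof.
move=> c0 hy Y1; set X := gen_series x.
have fam1 := pow_family_rising c; set H1 := rising_log c in fam1.
have fam2 := pow_family_shift fam1 b; set H2 := pow_shift H1 b in fam2.
have X0 : X 0%N = 0 by [].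
have fam3 := pow_family_comp fam2 X0; set H3 := fun s => _ in fam3.
have fam4 := pow_family_shift fam3 a; set H4 := pow_shift H3 a in fam4.
(* Hence every power of 1 + Y is a member of the last family. *)
have -> : Y1 = fps_of_log H4 1.
  apply/funext => n; rewrite /fps_of_log coef_fpsD coef_fpsCM mul1r; congr (_ + _).
  by case: n => [|n]; [rewrite fam4.1 | rewrite /= hy // bell_transformE].
rewrite !(fps_pow_family fam4).
have V3E s : fps_of_log H3 s = fps_comp (fps_of_log H2 s) X.
  by rewrite fps_compD fps_comp1 fps_compCM.
(* The case X = t, a = 0. Pulled back along t W1^(-b), with W1 the starting series, the left side
   becomes (1/c) (1 - W1^(-c)) W1^(-b) = t W1^(-b), the pullback of t. *)
have tE : fpsC c^-1 * ((1 - fps_of_log H2 (- c)) * fps_of_log H2 (- b)) = fps_t.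
  apply: (lagrange_comp_inj fam1 (a := b)); have p0 := lagrange_phi0 H1 b.
  rewrite fps_compCM fps_compM // fps_compB fps_comp1 !(lagrange_comp fam1) fps_compt //.
  rewrite rising_logN opprB addrC subrK.
  by rewrite !mulrA -rmorphM mulVf // rmorph1 mul1r.
(* Pulling back along t W3^(-a), with W3 the series of [H3], turns t (1 + Y)^a into t, so the left
   side becomes X; the right side becomes that of [tE] composed with X. *)
apply: (lagrange_comp_inj fam3 (a := a)); have p0 := lagrange_phi0 H3 a.
rewrite fps_compA ?coef_fps_tM // fps_comp_tM // (lagrange_comp fam3).
rewrite -mulrA -(pow_familyD fam3) addNr pow_family0 mulr1 fps_comp_idr.
rewrite fps_compCM fps_compM // fps_compB fps_comp1 !(lagrange_comp fam3) !V3E.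
by rewrite -{1}(fps_comp1 X) -fps_compB -fps_compM // -fps_compCM tE fps_compt.
Qed.

Theorem theorem3p1 (R : realType) (a b c : R[i]) (x y : nat -> R[i])
  (hc : c != 0)
  (hy : forall n : nat, (1 <= n)%N -> y n = bell_transform a b c 1 x n) :
  let X := gen_series x in
  let Y1 := fps_add fps_one (gen_series y) in
  fps_comp X (fps_mul fps_t (fps_pow Y1 a)) =1
  fps_scale c^-1
    (fps_mul (fps_sub fps_one (fps_pow Y1 (- c))) (fps_pow Y1 (- b))).
Proof.
move=> X Y1 n; have := congr1 (fun f => f n) (bell_transform_series hc hy).
by rewrite /= coef_fpsCM.
Qed.
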